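(* Let $\{A_n\}_{n\geqslant 1}$ be i.i.d. nonnegative random variables with Laplace–Stieltjes transform $\alpha(s)=\mathbb{E}[e^{-sA_1}]$, and let $\{B_n\}_{n\geqslant 1}$ be i.i.d. Erlang distributed with $N$ phases and rate $\mu>0$, independent of $\{A_n\}$. Let $W_1=w\geqslant 0$ and $W_{n+1}=\max\{0,\,B_{n+1}-A_n-W_n\}$ for $n\geqslant 1$. Define, for $i,j\in\{1,\dots,N\}$, $$p_{ij}=\frac{(-\mu)^{N-j}}{2^i}\sum_{\ell=0}^{N-j}\binom{i+\ell-1}{i-1}\frac{\alpha^{(N-j-\ell)}(\mu)}{(N-j-\ell)!}\left(-\frac{1}{2\mu}\right)^{\ell},\qquad p_{0j}=\frac{(-\mu)^{N-j}}{(N-j)!}\alpha^{(N-j)}(\mu),$$ and $p_{i0}=1-\sum_{j=1}^N p_{ij}$ for $i\in\{0,\dots,N\}$. Define $$\varpi_{2,j}=(-\mu)^{N-j}e^{-\mu w}\sum_{\ell=0}^{N-j}\frac{(-w)^{\ell}}{\ell!}\frac{\alpha^{(N-j-\ell)}(\mu)}{(N-j-\ell)!},\quad j=1,\dots,N,\qquad \varpi_{2,0}=1-\sum_{j=1}^N\varpi_{2,j},$$ and recursively $\varpi_{n,j}=\sum_{i=0}^N\varpi_{n-1,i}\,p_{ij}$ for $n\geqslant 3$, $j\in\{0,\dots,N\}$ (i.e. $\varpi_n^{\mathrm T}=\varpi_2^{\mathrm T}\mathbf P^{n-2}$ with $\mathbf P=(p_{ij})_{i,j=0}^N$). Then for every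 $n\geqslant 2$, $W_n$ has a mixed-Erlang distribution: $$\mathbb{P}[W_n\leqslant x]=\sum_{i=0}^N\varpi_{n,i}\,G_i(x),\qquad x\geqslant 0.$$
   Context: $\alpha^{(m)}$ denotes the $m$-th derivative of $\alpha$. $G_i$ denotes the distribution function of the Erlang distribution with $i$ phases and rate $\mu$ for $i\geqslant 1$, and $G_0(x)=1$ for $x\geqslant0$ (point mass at $0$). The numbers $\varpi_{n,i}$ equal $\mathbb{P}[F_n=i]$, where $F_n$ is the number of remaining exponential preparation phases at the moment the $n$-th waiting time starts; $(F_n)$ is a Markov chain with transition probabilities $p_{ij}$. *)

(* Defs.v *)
From HB Require Import structures.
From mathcomp Require Import all_boot all_order all_algebra.
From mathcomp Require Import all_classical all_reals all_analysis.
Set Implicit Arguments. Unset Strict Implicit. Unset Printing Implicit Defensive.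
Import Order.TTheory GRing.Theory Num.Theory.
Local Open Scope classical_set_scope.
Local Open Scope ring_scope.

Definition mutually_independent d (T : measurableType d) (R : realType)
  (P : probability T R) (I : eqType) (J : I -> Prop) (X : I -> T -> R) : Prop :=
  forall (F : seq I) (E : I -> set R),
    uniq F -> (forall i, i \in F -> J i) -> (forall i, measurable (E i)) ->
    P (\bigcap_(i in [set i | i \in F]) (X i @^-1` E i)) =
    (\prod_(i <- F) P (X i @^-1` E i))%E.

Definition join_seq (T R : Type) (A B : nat -> T -> R) (k : nat + nat) : T -> R :=
  match k with inl n => A n | inr n => B n end.

Definition pos_index (k : nat + nat) : Prop :=
  match k with inl n => (1 <= n)%N | inr n => (1 <= n)%N end.

(* G_i: cdf of the Erlang distribution with i phases and rate mu; G_0 is the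
   cdf of the point mass at 0. *)
Definition erlang_cdf (R : realType) (mu : R) (i : nat) (x : R) : R :=
  if x < 0 then 0
  else 1 - \sum_(k < i) expR (- (mu * x)) * (mu * x) ^+ k / (k`!)%:R.

Definition lst d (T : measurableType d) (R : realType) (P : probability T R)
  (X : T -> R) (s : R) : R :=
  fine ('E_P[fun t => expR (- (s * X t))])%E.

Section Chain.
Variables (R : realType) (N : nat) (mu w : R) (a : nat -> R).
(* a m stands for alpha^{(m)}(mu). *)

Definition p_pos (i j : nat) : R :=
  if i == 0%N then (- mu) ^+ (N - j) / ((N - j)`!)%:R * a (N - j)
  else (- mu) ^+ (N - j) / 2 ^+ i *
       \sum_(l < (N - j).+1)
         ('C(i + l - 1, i - 1))%:R * (a (N - j - l) / ((N - j - l)`!)%:R)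
         * (- (2 * mu)^-1) ^+ l.

Definition ptrans (i j : nat) : R :=
  if j == 0%N then 1 - \sum_(1 <= j' < N.+1) p_pos i j' else p_pos i j.

Definition varpi2_pos (j : nat) : R :=
  (- mu) ^+ (N - j) * expR (- (mu * w)) *
  \sum_(l < (N - j).+1) (- w) ^+ l / (l`!)%:R * (a (N - j - l) / ((N - j - l)`!)%:R).

Definition varpi2 (j : nat) : R :=
  if j == 0%N then 1 - \sum_(1 <= j' < N.+1) varpi2_pos j' else varpi2_pos j.

Fixpoint varpi_aux (k : nat) (j : nat) : R :=
  match k with
  | 0 => varpi2 j
  | k'.+1 => \sum_(i < N.+1) varpi_aux k' i * ptrans i j
  end.

Definition varpi (n j : nat) : R := varpi_aux (n - 2) j.
End Chain.

(* W_1 = w, W_{n+1} = max(0, B_{n+1} - A_n - W_n) for n >= 1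
   (W_0 is an irrelevant dummy value). *)
Fixpoint Wseq (T : Type) (R : realType) (w : R) (A B : nat -> T -> R)
  (n : nat) (t : T) : R :=
  match n with
  | 0 => w
  | 1 => w
  | m.+1 => Num.max 0 (B m.+1 t - A m t - Wseq w A B m t)
  end.

(* Main.v *)
(* Write h_k(x) = exp(-mu x) (mu x)^k / k! for the Poisson weights, so that the
   Erlang law with n phases has tail h_0 + ... + h_(n-1).  Conditioning on
   S = A_n + W_n, which is independent of B_(n+1), gives
   P(W_(n+1) > x) = E[sum_(k < N) h_k(x + S)] for x >= 0, and the convolution
   identity h_k(x + y) = sum_l h_(k-l)(x) h_l(y), applied twice, turns this into
   sum_(k < N) sum_(l <= k) h_(k-l)(x) sum_(c <= l) E[h_(l-c)(A_n)] E[h_c(W_n)].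
   This is the tail of a mixture of Erlang laws whose weight at j >= 1 is
   sum_(c <= N-j) E[h_(N-j-c)(A_n)] E[h_c(W_n)].  Differentiating the transform
   under the integral sign yields E[h_b(A_n)] = (-mu)^b alpha^(b)(mu) / b!, and
   if W_n is itself a mixture of Erlang laws, E[h_c(W_n)] is the mixture of the
   negative binomial weights 'C(i+c-1, i-1) / 2^(i+c): the probability that c
   events of one Poisson clock precede the i-th event of an independent one. *)
Require Import Defs.
From HB Require Import structures.
From mathcomp Require Import all_boot all_order all_algebra.
From mathcomp Require Import all_classical all_reals all_analysis.
From mathcomp Require Import measurable_realfun ring lra.
Set Implicit Arguments. Unset Strict Implicit. Unset Printing Implicit Defensive.
Import Order.TTheory GRing.Theory Num.Theory.
Import numFieldNormedType.Exports.
Local Open Scope classical_set_scope.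
Local Open Scope ring_scope.

(** * Poisson weights and the Erlang law *)

Definition erlang_term {R : realType} (mu : R) (k : nat) (x : R) : R :=
  expR (- (mu * x)) * (mu * x) ^+ k / k`!%:R.

Definition erlang_tail {R : realType} (mu : R) (n : nat) (x : R) : R :=
  \sum_(k < n) erlang_term mu k x.

Section ErlangTerm.
Variables (R : realType) (mu : R).
Hypothesis mu_gt0 : 0 < mu.
Local Notation h := (erlang_term mu).
Local Notation tail := (erlang_tail mu).

Lemma erlang_cdfE n x : 0 <= x -> erlang_cdf mu n x = 1 - tail n x.
Proof. by move=> x0; rewrite /erlang_cdf ltNge x0. Qed.

Lemma erlang_term_ge0 k x : 0 <= x -> 0 <= h k x.
Proof.
by move=> x0; rewrite divr_ge0// mulr_ge0 ?expR_ge0// exprn_ge0// mulr_ge0// ltW.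
Qed.

(** For [k > 0], the exponential series dominates each of its terms. This uniform bound later
    supplies every integrability and domination argument. *)
Lemma erlang_term_le1 k x : 0 <= x -> h k x <= 1.
Proof.
move=> x0; have mx0 : 0 <= mu * x by rewrite mulr_ge0// ltW.
rewrite /erlang_term expRN -mulrA ler_pdivrMl ?expR_gt0// mulr1.
case: k => [|k]; first by rewrite expr0 divr1 -expR0 ler_expR.
by apply: le_trans (expR_ge1Dxn k mx0); rewrite lerDr.
Qed.

(** The binomial theorem, read as the additivity of independent Poisson counts over consecutive
    intervals. *)
Lemma erlang_termD k x y :
  h k (x + y) = \sum_(l < k.+1) h (k - l) x * h l y.
Proof.
rewrite /erlang_term mulrDr opprD expRD exprDn mulr_sumr mulr_suml.
apply: eq_bigr => l _.
have lk : (l <= k)%N by rewrite -ltnS.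
have /(congr1 (fun n => n%:R : R)) := bin_fact lk.
rewrite !natrM => <-; rewrite -mulr_natr.
have [f0 f1] : (l`!)%:R != 0 :> R /\ ((k - l)`!)%:R != 0 :> R.
  by rewrite !pnatr_eq0 -!lt0n !fact_gt0.
have b0 : ('C(k, l))%:R != 0 :> R by rewrite pnatr_eq0 -lt0n bin_gt0.
by field; rewrite f0 f1 b0.
Qed.

Lemma erlang_tail0 k : tail k.+1 0 = 1.
Proof.
rewrite /erlang_tail big_ord_recl big1 ?addr0 => [|i _].
  by rewrite /erlang_term mulr0 oppr0 expR0 expr0 divr1 mulr1.
by rewrite /erlang_term mulr0 exprS mul0r mulr0 mul0r.
Qed.

(** Kolmogorov's forward equation of the Poisson process, with the convention h_(-1) = 0. *)
Lemma is_derive_erlang_term (k : nat) (x : R) :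
  is_derive x 1 (h k) (mu * ((if k is k'.+1 then h k' x else 0) - h k x)).
Proof.
have lin : is_derive x (1:R) (fun z : R => mu * z) mu.
  by apply: is_derive_eq; rewrite -[RHS]mulr1.
have dexp : is_derive x (1:R) (fun z => expR (- (mu * z))) (- mu * expR (- (mu * x))).
  have H := @is_derive1_comp _ expR (fun z => - (mu * z)) x _ _
    (is_derive_expR _) (is_deriveN lin).
  by apply: is_derive_eq H _; rewrite mulrC.
case: k => [|k].
  rewrite /erlang_term (_ : (fun z => _) = (fun z => expR (- (mu * z)))).
    by apply: is_derive_eq dexp _; rewrite expr0 divr1; ring.
  by apply/funext => z; rewrite expr0 mulr1 divr1.
have dpow : is_derive x (1:R) (fun z => (mu * z) ^+ k.+1) (k.+1%:R * mu * (mu * x) ^+ k).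
  have H := is_deriveX k.+1 lin.
  rewrite exprfctE in H.
  apply: is_derive_eq H _; rewrite /= -[LHS]/(_ * _); ring.
have H := is_deriveM (is_deriveM dexp dpow) (is_derive_cst ((k.+1`!)%:R^-1 : R) x 1).
apply: is_derive_eq H _ => /=.
rewrite /erlang_term scaler0 add0r !scalerDr -![_ *: _]/(_ * _) factS natrM.
have f0 : (k`!)%:R != 0 :> R by rewrite pnatr_eq0 -lt0n fact_gt0.
have k0 : (k.+1)%:R != 0 :> R by rewrite pnatr_eq0.
rewrite exprS.
by field; rewrite f0 -natr1 in k0 *; rewrite addrC k0.
Qed.

(** The forward equations telescope; hence mu h_k is the density of the Erlang law with k+1
    phases. *)
Lemma is_derive_erlang_tail (k : nat) (x : R) : is_derive x 1 (tail k.+1) (- (mu * h k x)).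
Proof.
have -> : tail k.+1 = \sum_(j < k.+1) h j.
  by apply/funext => z; rewrite fct_sumE.
have H := is_derive_sum (fun j : 'I_k.+1 => is_derive_erlang_term j x).
apply: is_derive_eq H _.
rewrite -mulr_sumr -mulrN; congr (_ * _).
elim: k => [|k IH]; first by rewrite big_ord_recl big_ord0 addr0 sub0r.
by rewrite big_ord_recr /= IH addKr.
Qed.

Lemma erlang_term_cvgy k : h k x @[x --> +oo] --> 0.
Proof.
(* The upper bound is h_(k+1) <= 1 rewritten through h_(k+1)(x) = h_k(x) mu x / (k+1). *)
apply: (@squeeze_cvgr _ _ _ _ (cst 0) (fun x => (k.+1%:R / mu) * x^-1)).
- near=> x.
  have x0 : 0 < x by near: x; apply: nbhs_pinfty_gt.
  rewrite erlang_term_ge0 ?(ltW x0)//=.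
  have mx0 : 0 < mu * x by rewrite mulr_gt0.
  have := @erlang_term_le1 k.+1 x (ltW x0).
  have -> : h k.+1 x = h k x * ((mu * x) / k.+1%:R).
    rewrite /erlang_term factS natrM exprS.
    have f0 : (k`!)%:R != 0 :> R by rewrite pnatr_eq0 -lt0n fact_gt0.
    have k0 : (k.+1)%:R != 0 :> R by rewrite pnatr_eq0.
    by field; rewrite f0 -natr1 in k0 *; rewrite addrC k0.
  rewrite -ler_pdivlMr ?divr_gt0// => /le_trans; apply.
  by rewrite mul1r invf_div invfM mulrA.
- exact: cvg_cst.
- rewrite -[X in _ --> X](mulr0 (k.+1%:R / mu)).
  by apply: cvgMr; apply/(@gtr0_cvgV0 _ _ _ _ id) => //; exact: nbhs_pinfty_gt.
Unshelve. all: end_near. Qed.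

Lemma erlang_tail_cvgy k : tail k x @[x --> +oo] --> 0.
Proof.
rewrite (_ : tail k = \sum_(j < k) h j); last first.
  by apply/funext => z; rewrite fct_sumE.
elim: k => [|k IH].
  by rewrite big_ord0; exact: cvg_cst.
rewrite big_ord_recr /= -[X in _ --> X]addr0; apply: cvgD => //.
exact: erlang_term_cvgy.
Qed.

Lemma continuous_erlang_term k : continuous (h k).
Proof.
move=> x; apply/differentiable_continuous/derivable1_diffP.
by have [] := is_derive_erlang_term k x.
Qed.

Lemma measurable_erlang_term k : measurable_fun setT (h k).
Proof. exact: continuous_measurable_fun (@continuous_erlang_term k). Qed.

Lemma integral_erlang_term k y : 0 <= y ->
  (\int[lebesgue_measure]_(u in `[y, +oo[) (mu * h k u)%:E = (tail k.+1 y)%:E)%E.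
Proof.
move=> y0.
rewrite (@ge0_continuous_FTC2y R _ (fun u => - tail k.+1 u) y 0).
- by rewrite -EFinB sub0r opprK.
- by move=> u yu; rewrite mulr_ge0 ?(ltW mu_gt0)// erlang_term_ge0// (le_trans y0).
- apply: continuous_subspaceT => u; apply: cvgMr; exact: continuous_erlang_term.
- rewrite -oppr0; apply: cvgN; exact: erlang_tail_cvgy.
- by move=> u _; have [] := is_deriveN (is_derive_erlang_tail k u).
- apply: cvg_at_right_filter; apply: cvgN.
  by apply/differentiable_continuous/derivable1_diffP;
    have [] := is_derive_erlang_tail k y.
- move=> u _; rewrite derive1E.
  by have [_ ->] := is_deriveN (is_derive_erlang_tail k u); rewrite opprK.
Qed.

End ErlangTerm.

(** * Independence *)

(* The measurability hypotheses are arguments so that the measure structure of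
   [law_on] can be inferred. *)
Definition law_on d d' (T : measurableType d) (T' : measurableType d')
    (R : realType) (P : probability T R) (C : set T) (Z : T -> T')
    of measurable C & measurable_fun setT Z :=
  fun M : set T' => P (Z @^-1` M `&` C).

Section LawOn.
Context d d' (T : measurableType d) (T' : measurableType d') (R : realType).
Variables (P : probability T R) (C : set T) (Z : T -> T').
Hypotheses (mC : measurable C) (mZ : measurable_fun setT Z).

Let mpreZ M : measurable M -> measurable (Z @^-1` M).
Proof. by move=> mM; rewrite -[X in measurable X]setTI; exact: mZ. Qed.

Let law_on0 : law_on P mC mZ set0 = 0%E.
Proof. by rewrite /law_on preimage_set0 set0I measure0. Qed.

Let law_on_ge0 M : (0 <= law_on P mC mZ M)%E.
Proof. exact: measure_ge0. Qed.

Let law_on_sigma_additive : semi_sigma_additive (law_on P mC mZ).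
Proof.
move=> F mF tF mUF; rewrite /law_on preimage_bigcup setI_bigcupl.
apply: measure_semi_sigma_additive.
- by move=> n; apply: measurableI => //; exact: mpreZ.
- apply/trivIsetP => i j _ _ ij; rewrite setIACA -preimage_setI.
  by move/trivIsetP : tF => /(_ _ _ I I ij) ->; rewrite preimage_set0 set0I.
- rewrite -setI_bigcupl -preimage_bigcup.
  by apply: measurableI => //; exact: mpreZ.
Qed.

HB.instance Definition _ := isMeasure.Build _ _ _ (law_on P mC mZ)
  law_on0 law_on_ge0 law_on_sigma_additive.

Let law_on_fin : fin_num_fun (law_on P mC mZ).
Proof.
by move=> M mM; apply: fin_num_measure; apply: measurableI => //; exact: mpreZ.
Qed.

HB.instance Definition _ := Measure_isFinite.Build _ _ _ (law_on P mC mZ)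
  law_on_fin.

End LawOn.

Section IndependentPair.
Context d d1 d2 (T : measurableType d) (T1 : measurableType d1)
  (T2 : measurableType d2) (R : realType).
Variables (P : probability T R) (X : T -> T1) (Y : T -> T2).
Hypotheses (mX : measurable_fun setT X) (mY : measurable_fun setT Y).

(* Both sides of the conclusion are finite measures in [M] that agree on the rectangles. *)
Lemma independent_pair (C : set T) : measurable C ->
  (forall U V, measurable U -> measurable V ->
    P (X @^-1` U `&` Y @^-1` V) = P (X @^-1` U) * P (Y @^-1` V))%E ->
  (forall U V, measurable U -> measurable V ->
    P (X @^-1` U `&` Y @^-1` V `&` C) = P (X @^-1` U) * P (Y @^-1` V) * P C)%E ->
  forall M, measurable M ->
    (P ((fun t => (X t, Y t)) @^-1` M `&` C) =
     P ((fun t => (X t, Y t)) @^-1` M) * P C)%E.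
Proof.
move=> mC XY XYC M mM.
have mXY : measurable_fun setT (fun t => (X t, Y t)).
  exact: measurable_fun_pair.
have XC U : measurable U -> (P (X @^-1` U `&` C) = P (X @^-1` U) * P C)%E.
  move=> mU; have := XYC U setT mU measurableT.
  by rewrite preimage_setT setIT probability_setT mule1.
have c0 : 0 <= fine (P C) by rewrite fine_ge0.
have PCE : (P C = (fine (P C))%:E)%E by rewrite fineK// fin_num_measure.
have H1 := @product_measure_unique _ _ _ _ _ (law_on P mC mX)
  (law_on P measurableT mY) (law_on P mC mXY).
have H2 := @product_measure_unique _ _ _ _ _ (law_on P mC mX)
  (law_on P measurableT mY) (mscale (NngNum c0) (law_on P measurableT mXY)).
(* The intermediate measure is the product of the law of X restricted to C with the full law of Y.
   [H1] identifies it with the joint law restricted to C, [H2] with P(C) times the joint law. *)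
transitivity ((law_on P mC mX \x law_on P measurableT mY)%E M).
  rewrite H1 // => U V mU mV; rewrite /= /law_on setIT XC//.
  by rewrite -[(fun t => (X t, Y t)) @^-1` _]/(X @^-1` U `&` Y @^-1` V) XYC// muleAC.
rewrite H2 //=.
  by rewrite /mscale /= -PCE /law_on setIT muleC.
move=> U V mU mV; rewrite /= /mscale /= -PCE /law_on /= !setIT XC//.
rewrite -[(fun t => (X t, Y t)) @^-1` _]/(X @^-1` U `&` Y @^-1` V) XY//.
by rewrite muleC muleAC.
Qed.

(** Independence makes the joint law the product of the marginals, and Tonelli iterates the
    integral. *)
Lemma independent_integral (g : T1 * T2 -> \bar R) :
  (forall U V, measurable U -> measurable V ->
    P (X @^-1` U `&` Y @^-1` V) = P (X @^-1` U) * P (Y @^-1` V))%E ->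
  measurable_fun setT g -> (forall z, 0 <= g z)%E ->
  (\int[P]_t g (X t, Y t) = \int[P]_s \int[P]_t g (X s, Y t))%E.
Proof.
move=> XY mg g0.
have mXY : measurable_fun setT (fun t => (X t, Y t)).
  exact: measurable_fun_pair.
pose mX' : {mfun T >-> T1} := HB.pack X (isMeasurableFun.Build _ _ _ _ X mX).
pose mY' : {mfun T >-> T2} := HB.pack Y (isMeasurableFun.Build _ _ _ _ Y mY).
pose mXY' : {mfun T >-> (T1 * T2)%type} :=
  HB.pack (fun t => (X t, Y t)) (isMeasurableFun.Build _ _ _ _ _ mXY).
transitivity (\int[distribution P mXY']_z g z)%E.
  by rewrite (ge0_integral_distribution mXY').
transitivity (\int[(distribution P mX' \x distribution P mY')%E]_z g z)%E.
  apply: eq_measure_integral => M mM _; apply/esym.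
  apply: product_measure_unique => // U V mU mV.
rewrite fubini_tonelli1//.
rewrite (ge0_integral_distribution mX').
- apply: eq_integral => s _ /=.
  rewrite /fubini_F (ge0_integral_distribution mY')//.
  exact: measurableT_comp mg (pair1_measurable _).
- exact: measurable_fun_fubini_tonelli_F.
- by move=> s; apply: integral_ge0.
Qed.

End IndependentPair.

(** Taking S to be the whole line shows that this also contains the mutual independence of the
    family over K. Both facts together form the invariant carried along the recursion. *)
Definition independent_of d (T : measurableType d) (R : realType)
  (P : probability T R) (I : eqType) (K : I -> Prop) (X : I -> T -> R)
  (Z : T -> R) : Prop :=
  forall (F : seq I) (E : I -> set R) (S : set R),
    uniq F -> (forall i, i \in F -> K i) -> (forall i, measurable (E i)) ->
    measurable S ->
    P (Z @^-1` S `&` \bigcap_(i in [set i | i \in F]) (X i @^-1` E i)) =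
    (P (Z @^-1` S) * \prod_(i <- F) P (X i @^-1` E i))%E.

Section IndependentOf.
Context d (T : measurableType d) (R : realType).
Variables (P : probability T R) (I : choiceType) (X : I -> T -> R).
Hypothesis mX : forall i, measurable_fun setT (X i).

(** Each event of a constant is either everything or empty. This starts the induction at W_1 = w. *)
Lemma independent_of_cst (K : I -> Prop) w :
  mutually_independent P K X -> independent_of P K X (cst w).
Proof.
move=> iX F E S uF KF mE mS; have [Sw|Sw] := pselect (S w).
  rewrite (_ : cst w @^-1` S = setT); last by apply/seteqP; split.
  by rewrite setTI probability_setT mul1e iX.
rewrite (_ : cst w @^-1` S = set0); last by apply/seteqP; split.
by rewrite set0I measure0 mul0e.
Qed.

Lemma independent_ofW (K K' : I -> Prop) Z :
  (forall i, K' i -> K i) -> independent_of P K X Z -> independent_of P K' X Z.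
Proof. by move=> KK iZ F E S uF KF; apply: iZ => // i /KF /KK. Qed.

Lemma independent_of_eq (K : I -> Prop) Z i U V :
  independent_of P K X Z -> K i -> measurable U -> measurable V ->
  (P (Z @^-1` U `&` X i @^-1` V) = P (Z @^-1` U) * P (X i @^-1` V))%E.
Proof.
move=> iZ Ki mU mV; have := iZ [:: i] (fun=> V) U erefl.
rewrite bigcap_seq !big_seq1; apply => // j.
by rewrite inE => /eqP ->.
Qed.

(** The variable X_i is absorbed into Z and leaves the family. [independent_pair] applies to (Z,
    X_i) with C an event of the remaining variables. *)
Lemma independent_of_comp (K : I -> Prop) Z i (f : R * R -> R) :
  independent_of P K X Z -> K i -> measurable_fun setT Z ->
  measurable_fun setT f ->
  independent_of P (fun j => K j /\ j != i) X (fun t => f (Z t, X i t)).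
Proof.
move=> iZ Ki mZ mf F E S uF KF mE mS.
set C := \bigcap_(j in _) _.
have mC : measurable C.
  rewrite /C bigcap_seq; apply: big_ind => //; first exact: measurableI.
  by move=> j _; rewrite -[X in measurable X]setTI; exact: mX.
have PC : P C = (\prod_(j <- F) P (X j @^-1` E j))%E.
  have := iZ F E setT uF (fun j jF => (KF j jF).1) mE measurableT.
  by rewrite preimage_setT setTI probability_setT mul1e.
have iF : i \notin F by apply/negP => /KF[_]; rewrite eqxx.
have mfS : measurable (f @^-1` S).
  by rewrite -[X in measurable X]setTI; exact: mf.
have ZX := fun U V => @independent_of_eq K Z i U V iZ Ki.
rewrite (@independent_pair _ _ _ T R R R P Z (X i) mZ (mX i) C mC ZX _ _ mfS).
  by rewrite PC.
move=> U V mU mV.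
(* Placing V at index i turns the hypothesis on [i :: F] into the triple product that
   [independent_pair] asks for. *)
pose E' j := if j == i then V else E j.
have := iZ (i :: F) E' U; rewrite /= iF => /(_ uF).
have E'F j : j \in F -> E' j = E j.
  by move=> jF; rewrite /E'; case: eqP => // ji; rewrite -ji jF in iF.
rewrite bigcap_seq !big_cons /E' eqxx.
rewrite (eq_big_seq (fun j => X j @^-1` E j)); last by move=> j /E'F; rewrite /E' => ->.
rewrite -bigcap_seq -/C setIA => ->//.
- rewrite muleA (eq_big_seq (fun j => P (X j @^-1` E j))) ?PC//.
  by move=> j /E'F; rewrite /E' => ->.
- by move=> j; rewrite inE => /predU1P[->//|/KF[]].
- by move=> j; case: ifP.
Qed.

End IndependentOf.

(** * Poisson weights at a mixed-Erlang time *)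

Section RintegralExtra.
Context d (T : measurableType d) (R : realType).

Lemma Rintegral_sum (mu : {measure set T -> \bar R}) (D : set T) (I : Type)
    (s : seq I) (f : I -> T -> R) : measurable D ->
  (forall i, mu.-integrable D (EFin \o f i)) ->
  \int[mu]_(x in D) (\sum_(i <- s) f i x) = \sum_(i <- s) \int[mu]_(x in D) f i x.
Proof.
move=> mD fi; rewrite /Rintegral.
under eq_integral do rewrite -sumEFin.
rewrite (integral_sum mD (f := fun i x => (f i x)%:E))// sum_fine//.
by move=> i _; exact: (integrable_fin_num mD (fi i)).
Qed.

Lemma integrable_scale (mu : {measure set T -> \bar R}) (D : set T) (f : T -> R)
    (k : R) : measurable D -> mu.-integrable D (EFin \o f) ->
  mu.-integrable D (EFin \o (fun x => k * f x)).
Proof. by move=> mD fi; exact: (integrableZl mD k fi). Qed.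

Lemma bounded_integrable (P : probability T R) (f : T -> R) (M : R) :
  measurable_fun setT f -> (forall t, `|f t| <= M) ->
  P.-integrable setT (EFin \o f).
Proof.
move=> mf fM; apply: measurable_bounded_integrable => //.
  exact: le_lt_trans (probability_le1 P measurableT) (ltry 1).
exists M; split; first by rewrite num_real.
by move=> y My t _ /=; rewrite (le_trans (fM t))// ltW.
Qed.

End RintegralExtra.

Section ErlangRace.
Variables (R : realType) (mu : R).
Hypothesis mu_gt0 : 0 < mu.
Local Notation h := (erlang_term mu).
Local Notation tail := (erlang_tail mu).
Local Notation leb := (@lebesgue_measure R).

(* [race i k] is the probability that [i] phases of one Poisson clock are
   completed before [k.+1] phases of an independent one with the same rate. *)
Definition race (i k : nat) : R :=
  1 - \sum_(j < i) 'C(k + j, j)%:R / 2 ^+ (k + j).+1.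

(** Superposing two clocks of rate mu gives a clock of rate 2 mu whose events are split by fair
    coins. The last factor is an Erlang density of rate 2 mu, so it integrates to one. *)
Lemma mul_erlang_term k j u :
  mu * h k u * h j u =
  'C(k + j, j)%:R / 2 ^+ (k + j).+1 * (2 * mu * erlang_term (2 * mu) (k + j) u).
Proof.
rewrite /erlang_term.
have -> : - (2 * mu * u) = - (mu * u) + - (mu * u) by ring.
rewrite expRD.
have -> : (2 * mu * u) ^+ (k + j) = 2 ^+ (k + j) * ((mu * u) ^+ k * (mu * u) ^+ j).
  by rewrite -exprD -exprMn; congr (_ ^+ _); ring.
have /(congr1 (fun n => n%:R : R)) := bin_fact (leq_addl k j).
rewrite addnK !natrM => <-; rewrite exprS.
have [f0 f1] : (j`!)%:R != 0 :> R /\ (k`!)%:R != 0 :> R.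
  by rewrite !pnatr_eq0 -!lt0n !fact_gt0.
have b0 : ('C(k + j, j))%:R != 0 :> R by rewrite pnatr_eq0 -lt0n bin_gt0 leq_addl.
have t0 : 2 ^+ (k + j) != 0 :> R by rewrite expf_neq0.
by field; rewrite f0 f1 b0 t0.
Qed.

Lemma integrable_erlang_term k (nu : R) : 0 < nu ->
  leb.-integrable `[0, +oo[ (EFin \o (fun u => nu * erlang_term nu k u)).
Proof.
move=> nu0; apply/integrableP; split.
  apply/measurable_EFinP/measurable_funTS/measurable_funM => //.
  exact: measurable_erlang_term.
rewrite [X in (X < _)%E](_ : _ =
    \int[leb]_(u in `[0%R, +oo[) (nu * erlang_term nu k u)%:E)%E.
  by rewrite integral_erlang_term// ltry.
apply: eq_integral => u; rewrite inE /= in_itv/= andbT => u0.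
by rewrite ger0_norm// mulr_ge0 ?(ltW nu0)// erlang_term_ge0.
Qed.

Lemma Rintegral_erlang_term k (nu : R) : 0 < nu ->
  \int[leb]_(u in `[0, +oo[) (nu * erlang_term nu k u) = 1.
Proof.
by move=> nu0; rewrite /Rintegral integral_erlang_term//= erlang_tail0.
Qed.

(** Expanding the distribution function as one minus its tail leaves only products handled by
    [mul_erlang_term]. *)
Lemma race_integral i k :
  leb.-integrable `[0, +oo[ (EFin \o (fun u => mu * h k u * erlang_cdf mu i u)) /\
  \int[leb]_(u in `[0, +oo[) (mu * h k u * erlang_cdf mu i u) = race i k.
Proof.
have nu0 : 0 < 2 * mu by rewrite mulr_gt0.
pose c j : R := 'C(k + j, j)%:R / 2 ^+ (k + j).+1.
pose F i u : R := mu * h k u -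
   \sum_(j <- index_enum 'I_i) c j * (2 * mu * erlang_term (2 * mu) (k + j) u).
have FE : {in (`[0, +oo[%classic : set R), forall u, mu * h k u * erlang_cdf mu i u = F i u}.
  move=> u; rewrite inE /= in_itv/= andbT => u0.
  rewrite erlang_cdfE// mulrBr mulr1 /F; congr (_ - _).
  by rewrite mulr_sumr; apply: eq_bigr => j _; rewrite mul_erlang_term.
have intc j : leb.-integrable `[0, +oo[
    (EFin \o (fun u => c j * (2 * mu * erlang_term (2 * mu) (k + j) u))).
  by apply: integrable_scale => //; exact: integrable_erlang_term.
have ints : leb.-integrable `[0, +oo[ (EFin \o (fun u =>
   \sum_(j <- index_enum 'I_i) c j * (2 * mu * erlang_term (2 * mu) (k + j) u))).
  rewrite (_ : EFin \o _ = fun u => \sum_(j <- index_enum 'I_i)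
     (c j * (2 * mu * erlang_term (2 * mu) (k + j) u))%:E)%E; last first.
    by apply/funext => u; rewrite sumEFin.
  by apply: integrable_sum => // j _; exact: intc.
split.
  apply: (@eq_integrable _ _ R leb _ _ (EFin \o F i)) => //.
    by move=> u uD /=; rewrite FE.
  have := fun m => integrableB m (integrable_erlang_term k mu_gt0) ints.
  by move=> H; apply: (@eq_integrable _ _ R leb) (H _).
transitivity (\int[leb]_(u in `[0, +oo[) F i u).
  by apply: eq_Rintegral => u; exact: FE.
rewrite /F RintegralB//; last exact: integrable_erlang_term.
rewrite Rintegral_erlang_term// Rintegral_sum//.
congr (_ - _); apply: eq_bigr => j _.
rewrite RintegralZl//; last exact: integrable_erlang_term.
by rewrite Rintegral_erlang_term// mulr1.
Qed.

(** The case [i = 0] is the point mass at 0; by truncated subtraction the general formula would give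
    2^(-k) there. *)
Definition erlang_race_pmf (i k : nat) : R :=
  if i == 0%N then (k == 0%N)%:R else 'C(i + k - 1, i - 1)%:R / 2 ^+ (i + k).

(** Both sides equal 2^(-i), the left one by a geometric sum. *)
Lemma race0 i : race i 0 = erlang_race_pmf i 0.
Proof.
rewrite /race; elim: i => [|i IH]; first by rewrite big_ord0 subr0.
rewrite big_ord_recr /= opprD addrA IH /erlang_race_pmf !add0n binn.
case: i {IH} => [|i]; rewrite /= ?addn0.
  by rewrite expr1 subn1 /= bin0; lra.
rewrite !subn1 /= !binn [2 ^+ i.+2]exprS.
have t0 : 2 ^+ i.+1 != 0 :> R by rewrite expf_neq0.
by field; rewrite t0.
Qed.

(** Induction on i; the new summands combine with the previous weight by Pascal's rule. *)
Lemma raceS i k : race i k.+1 - race i k = erlang_race_pmf i k.+1.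
Proof.
rewrite /race; elim: i => [|i IH]; first by rewrite !big_ord0 subr0 subrr.
rewrite !big_ord_recr /=.
transitivity (erlang_race_pmf i k.+1 +
  ('C(k + i, i)%:R / 2 ^+ (k + i).+1 - 'C(k.+1 + i, i)%:R / 2 ^+ (k.+1 + i).+1)).
  by rewrite -IH; ring.
rewrite /erlang_race_pmf !addSn !subn1 /= (addnC i) addSn.
have t0 (n : nat) : 2 ^+ n != 0 :> R by rewrite expf_neq0.
case: i {IH} => [|i] /=.
  by rewrite !bin0 !exprS; field; rewrite t0.
by rewrite binS natrD !addnS !exprS /=; field; rewrite t0.
Qed.

Context d (T : measurableType d) (P : probability T R) (Z : T -> R).
Hypotheses (mZ : measurable_fun setT Z) (Z0 : forall t, 0 <= Z t).

(* Tonelli for the indicator of [Z t <= u], weighted by the density of the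
   Erlang law with [k.+1] phases. *)
Lemma integral_erlang_tail k :
  (\int[P]_t (tail k.+1 (Z t))%:E =
   \int[leb]_(u in `[0%R, +oo[) ((mu * h k u)%:E * P (Z @^-1` [set y | (y <= u)%R])))%E.
Proof.
pose D : set (T * R) := [set z | Z z.1 <= z.2].
have mD : measurable D.
  rewrite -[D]setTI; apply: measurable_fun_le => //.
  exact: measurableT_comp.
pose f := (fun z : T * R => (mu * h k z.2)%:E) \_ D.
have mf : measurable_fun setT f.
  apply: (measurable_restrictT _ mD).1; apply: measurable_funTS.
  apply/measurable_EFinP/measurable_funM => //.
  by apply: measurableT_comp => //; exact: measurable_erlang_term.
have f0 z : (0 <= f z)%E.
  rewrite /f patchE; case: ifPn => //; rewrite inE /D /= => Zz.
  by rewrite lee_fin mulr_ge0 ?(ltW mu_gt0)// erlang_term_ge0// (le_trans _ Zz).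
have := @fubini_tonelli _ _ _ _ _ P leb f mf f0.
rewrite (eq_integral (fun t => (tail k.+1 (Z t))%:E)); last first.
  move=> t _; rewrite -integral_erlang_term// [RHS]integral_mkcond.
  apply: eq_integral => u _; rewrite /f !patchE /=.
  rewrite (_ : (u \in `[Z t, +oo[%classic) = ((t, u) \in D))//.
  by apply/idP/idP; rewrite !inE /= in_itv/= andbT.
move=> ->; rewrite [RHS]integral_mkcond; apply: eq_integral => u _.
have mZu : measurable (Z @^-1` [set y | y <= u]).
  rewrite -[X in measurable X]setTI; apply: mZ => //.
  by rewrite -set_itvNyc; exact: measurable_itv.
transitivity (\int[P]_(t in Z @^-1` [set y | (y <= u)%R]) cst (mu * h k u)%:E t)%E.
  rewrite [RHS]integral_mkcond; apply: eq_integral => t _.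
  rewrite /f !patchE /=.
  rewrite (_ : (t \in Z @^-1` _) = ((t, u) \in D))//.
rewrite integral_cst// patchE; case: ifPn => //.
(* For u < 0 the event Z <= u is empty because Z is nonnegative, so restricting to the half-line
   loses nothing. *)
rewrite notin_setE /= in_itv/= andbT => /negP; rewrite -ltNge => u0.
rewrite (_ : _ @^-1` _ = set0) ?measure0 ?mule0//.
apply/seteqP; split => // t /= Zu.
by have := le_lt_trans Zu u0; rewrite ltNge Z0.
Qed.

Lemma measurable_erlang_term_comp k : measurable_fun setT (fun t => h k (Z t)).
Proof. by apply: measurableT_comp => //; exact: measurable_erlang_term. Qed.

Lemma integrable_erlang_term_comp k :
  P.-integrable setT (EFin \o (fun t => h k (Z t))).
Proof.
apply: (@bounded_integrable _ _ _ _ _ 1); first exact: measurable_erlang_term_comp.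
by move=> t; rewrite ger0_norm ?erlang_term_ge0// erlang_term_le1.
Qed.

(** The mean of [tail k.+1] at Z integrates the distribution function of Z against an Erlang
    density, which gives a mixture of [race i k]. Since h_k is the difference of consecutive tails,
    its mean is the mixture of the increments of [race]. *)
Lemma expectation_erlang_term_mixture N (v : 'I_N -> R) :
  (forall u, 0 <= u ->
    P (Z @^-1` [set y | y <= u]) = (\sum_(i < N) v i * erlang_cdf mu i u)%:E) ->
  forall k, \int[P]_t h k (Z t) = \sum_(i < N) v i * erlang_race_pmf i k.
Proof.
move=> PZ.
have Etail k : \int[P]_t tail k.+1 (Z t) = \sum_(i < N) v i * race i k.
  rewrite /Rintegral integral_erlang_tail.
  rewrite [X in fine X](_ : _ = \int[leb]_(u in `[0%R, +oo[)
      (\sum_(i <- index_enum 'I_N) v i * (mu * h k u * erlang_cdf mu i u))%:E)%E; last first.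
    apply: eq_integral => u; rewrite inE /= in_itv/= andbT => u0.
    rewrite PZ// -EFinM mulr_sumr; congr _%:E.
    by apply: eq_bigr => i _; ring.
  rewrite -/(Rintegral _ _ _) Rintegral_sum//; last first.
    move=> i; apply: integrable_scale => //; exact: (race_integral i k).1.
  apply: eq_bigr => i _; rewrite RintegralZl//; last exact: (race_integral i k).1.
  by rewrite (race_integral i k).2.
have tailS k : \int[P]_t tail k.+1 (Z t) = \sum_(j <- index_enum 'I_k.+1) \int[P]_t h j (Z t).
  transitivity (\int[P]_t \sum_(j <- index_enum 'I_k.+1) h j (Z t)); first by [].
  by apply: Rintegral_sum => // j; exact: integrable_erlang_term_comp.
case=> [|k].
  have := tailS 0%N; rewrite big_ord_recl big_ord0 addr0 Etail => <-.
  by apply: eq_bigr => i _; rewrite race0.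
have := tailS k.+1; rewrite big_ord_recr /= -tailS !Etail => Ek.
transitivity (\sum_(i < N) v i * race i k.+1 - \sum_(i < N) v i * race i k).
  by rewrite Ek; ring.
rewrite -sumrB.
by apply: eq_bigr => i _; rewrite -mulrBr raceS.
Qed.

End ErlangRace.

(** * Derivatives of the Laplace-Stieltjes transform *)

Section LaplaceStieltjes.
Context d (T : measurableType d) (R : realType) (P : probability T R).
Variable A : T -> R.
Hypotheses (mA : measurable_fun setT A) (A0 : P (A @^-1` [set y | 0 <= y]) = 1%E).

(** A rescaling of h_m <= 1; the bound is uniform in a and so serves as a dominating constant. *)
Lemma pow_mul_expRN_le (s a : R) m : 0 < s -> 0 <= a ->
  a ^+ m * expR (- (s * a)) <= m`!%:R / s ^+ m.
Proof.
move=> s0 a0; have := erlang_term_le1 s0 m a0.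
rewrite /erlang_term ler_pdivrMr ?ltr0n ?fact_gt0// mul1r => H.
rewrite ler_pdivlMr ?exprn_gt0//; apply: le_trans H.
rewrite [leLHS](_ : _ = expR (- (s * a)) * (s * a) ^+ m)//.
by rewrite exprMn; ring.
Qed.

(** A is nonnegative only almost surely; this version is so everywhere, which makes the bounds on
    Poisson weights pointwise. *)
Definition pos_part (t : T) : R := Num.max 0 (A t).

Lemma measurable_pos_part : measurable_fun setT pos_part.
Proof. exact: measurable_maxr. Qed.

Lemma pos_part_ge0 t : 0 <= pos_part t.
Proof. by rewrite /pos_part le_max lexx. Qed.

Lemma pos_part_ae : {ae P, forall t, pos_part t = A t}.
Proof.
have mA0 : measurable (A @^-1` [set y | 0 <= y]).
  rewrite -[X in measurable X]setTI; apply: mA => //.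
  by rewrite -set_itvcy; exact: measurable_itv.
exists (~` (A @^-1` [set y | 0 <= y])); split.
- exact: measurableC.
- by rewrite probability_setC// A0 subee.
- by move=> t /= H At; apply: H; rewrite /pos_part max_r.
Qed.

Lemma eq_integral_pos_part (g : R -> R) : measurable_fun setT g ->
  (\int[P]_t (g (A t))%:E = \int[P]_t (g (pos_part t))%:E)%E.
Proof.
move=> mg; apply: ae_eq_integral => //.
- by apply/measurable_EFinP; exact: measurableT_comp.
- apply/measurable_EFinP; apply: measurableT_comp => //.
  exact: measurable_pos_part.
- by apply: filterS pos_part_ae => t /= ->.
Qed.

Let f m (s : R) t := (- pos_part t) ^+ m * expR (- (s * pos_part t)).

Let mf m s : measurable_fun setT (f m s).
Proof.
have mp := measurable_pos_part.
apply: measurable_funM.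
  by apply: measurable_funX; exact: measurable_funN.
apply: measurableT_comp; first exact: measurable_expR.
by apply: measurable_funN; exact: measurable_funM.
Qed.

Let norm_f_le m s u t : 0 < u -> u <= s -> `|f m s t| <= m`!%:R / u ^+ m.
Proof.
move=> u0 us; apply: le_trans (pow_mul_expRN_le m u0 (pos_part_ge0 t)).
rewrite normrM normrX normrN !ger0_norm ?expR_ge0 ?pos_part_ge0//.
rewrite ler_wpM2l ?exprn_ge0 ?pos_part_ge0// ler_expR lerN2.
by rewrite ler_wpM2r// pos_part_ge0.
Qed.

Let is_derive_f m t (s : R) : is_derive s 1 (fun s => f m s t) (f m.+1 s t).
Proof.
have lin : is_derive s (1:R) (fun z : R => - (z * pos_part t)) (- pos_part t).
  have H := is_deriveN (is_deriveM (is_derive_id s (1 : R))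
    (is_derive_cst (pos_part t) s (1:R))).
  by apply: is_derive_eq H _; rewrite scaler0 add0r -[_ *: _]/(_ * _) mulr1.
have H := @is_derive1_comp _ expR _ s _ _ (is_derive_expR _) lin.
have H2 := is_deriveM (is_derive_cst ((- pos_part t) ^+ m) s (1:R)) H.
apply: is_derive_eq H2 _; rewrite /f scaler0 addr0 -[_ *: _]/(_ * _) exprS /=.
ring.
Qed.

Lemma derive1n_lst m s : 0 < s ->
  derive1n m (lst P A) s = \int[P]_t f m s t.
Proof.
elim: m s => [|m IH] s s0.
  rewrite derive1n0 /lst unlock /Rintegral /f.
  rewrite (eq_integral_pos_part (g := fun y => expR (- (s * y)))).
    by congr fine; apply: eq_integral => t _; rewrite expr0 mul1r.
  apply: measurableT_comp; first exact: measurable_expR.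
  by apply: measurable_funN; exact: measurable_funM.
rewrite derive1nS.
(* The induction hypothesis covers positive arguments only, which is enough near s. *)
have H : \forall z \near s, derive1n m (lst P A) z = \int[P]_t f m z t.
  near=> z; apply: IH; near: z; exact: lt_nbhsr.
rewrite derive1E (near_eq_derive _ H) ?oner_eq0// -derive1E.
have sI : [set` `]s / 2, s * 2[] s.
  by rewrite /= in_itv/=; apply/andP; split; lra.
(* The interval stays away from 0, so the bound at its left end s/2 dominates the derivative
   throughout. *)
have H2 := @differentiation_under_integral R _ T P (f m) setT measurableT s (s / 2) (s * 2) sI.
rewrite (H2 _ _ (cst (m.+1`!%:R / (s / 2) ^+ m.+1))).
- apply: eq_Rintegral => t _ /=; rewrite /partial1of2 derive1E.
  by have [_ ->] := is_derive_f m t s.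
- move=> x; rewrite /= in_itv/= => /andP[sx _].
  apply: (@bounded_integrable _ _ _ _ _ (m`!%:R / x ^+ m)) => // t.
  by apply: norm_f_le => //; lra.
- by move=> x t _ _; have [] := is_derive_f m t x.
- by move=> t; rewrite divr_ge0// exprn_ge0//; lra.
- by apply: (@bounded_integrable _ _ _ _ _ `|m.+1`!%:R / (s / 2) ^+ m.+1|).
- move=> x t; rewrite /= in_itv/= => /andP[sx _] _.
  rewrite partial1of2E; have [_ ->] := is_derive_f m t x.
  by apply: norm_f_le; lra.
Unshelve. all: by end_near. Qed.

Lemma expectation_erlang_term_lst mu b : 0 < mu ->
  \int[P]_t erlang_term mu b (pos_part t) =
  (- mu) ^+ b / b`!%:R * derive1n b (lst P A) mu.
Proof.
move=> mu0; rewrite derive1n_lst// -RintegralZl//.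
  apply: eq_Rintegral => t _; rewrite /erlang_term /f.
  have -> : (mu * pos_part t) ^+ b = (- mu) ^+ b * (- pos_part t) ^+ b.
    by rewrite -exprMn mulrNN.
  ring.
apply: (@bounded_integrable _ _ _ _ _ (b`!%:R / mu ^+ b)) => // t.
exact: norm_f_le.
Qed.

End LaplaceStieltjes.

(** * The waiting-time recursion *)

(** Exchanging the sums, a fixed l leaves m = k - l running below N - l; then j = N - l. *)
Lemma sum_convolution_tail (R : comRingType) (h e : nat -> R) N :
  \sum_(k < N) \sum_(l < k.+1) h (k - l)%N * e l =
  \sum_(1 <= j < N.+1) e (N - j)%N * \sum_(m < j) h m.
Proof.
rewrite big_add1 /= big_mkord.
transitivity (\sum_(l < N) e l * \sum_(m < N - l) h m).
  elim: N => [|N IH]; first by rewrite !big_ord0.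
  rewrite big_ord_recr /= IH [in RHS]big_ord_recr /= [X in _ + X]big_ord_recr /=.
  rewrite subSnn subnn addrA -big_split /= big_ord1 [_ * h _]mulrC.
  rewrite (_ : h ord0 = h 0%N)//; congr (_ + _).
  apply: eq_bigr => l _; rewrite subSn; last exact: ltnW.
  by rewrite big_ord_recr /= mulrDr; congr (_ + _); rewrite mulrC.
rewrite (reindex_inj rev_ord_inj) /=; apply: eq_bigr => j _.
by rewrite subKn.
Qed.

(** The weight at 0 completes the total mass to one, so the mixture is one minus the weighted Erlang
    tails, and these regroup into the double sum by [sum_convolution_tail]. *)
Lemma erlang_mixtureE (R : realType) (mu : R) N (e u : nat -> R) x :
  u 0%N = 1 - \sum_(1 <= j < N.+1) u j ->
  (forall j, (0 < j <= N)%N -> u j = e (N - j)%N) -> 0 <= x ->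
  \sum_(i < N.+1) u i * erlang_cdf mu i x =
  1 - \sum_(k < N) \sum_(l < k.+1) erlang_term mu (k - l) x * e l.
Proof.
move=> u0 ue x0; rewrite (sum_convolution_tail (fun m => erlang_term mu m x)).
rewrite -(big_mkord xpredT (fun i => u i * erlang_cdf mu i x)) big_ltn// u0.
rewrite erlang_cdfE// /erlang_tail big_ord0 subr0 mulr1.
set X := \sum_(1 <= j < _) u j; set Y := \sum_(1 <= j < _) _ * \sum_(m < _) _.
suff -> : \sum_(1 <= i < N.+1) u i * erlang_cdf mu i x = X - Y by ring.
rewrite -sumrB; apply: eq_big_nat => j /ue <-.
by rewrite erlang_cdfE// mulrBr mulr1.
Qed.

(** * One step of the recursion, for a generic nonnegative waiting time Z *)

Section LindleyStep.
Context d (T : measurableType d) (R : realType) (P : probability T R).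
Variables (mu : R) (N : nat) (A B Z : T -> R).
Hypotheses (mu_gt0 : 0 < mu) (mA : measurable_fun setT A)
  (mB : measurable_fun setT B) (mZ : measurable_fun setT Z)
  (Z0 : forall t, 0 <= Z t) (A0 : P (A @^-1` [set y | 0 <= y]) = 1%E)
  (PB : forall x, P (B @^-1` [set y | y <= x]) = (erlang_cdf mu N x)%:E).
Local Notation h := (erlang_term mu).
Let S t := pos_part A t + Z t.
Hypotheses (iZA : forall U V, measurable U -> measurable V ->
    (P (Z @^-1` U `&` A @^-1` V) = P (Z @^-1` U) * P (A @^-1` V))%E)
  (iSB : forall U V, measurable U -> measurable V ->
    (P (S @^-1` U `&` B @^-1` V) = P (S @^-1` U) * P (B @^-1` V))%E).

Let S0 t : 0 <= S t.
Proof. by rewrite addr_ge0// pos_part_ge0. Qed.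

Let mS : measurable_fun setT S.
Proof. by apply: measurable_funD => //; exact: measurable_pos_part. Qed.

Lemma expectation_erlang_termM i c :
  \int[P]_t (h i (pos_part A t) * h c (Z t)) =
  \int[P]_t h i (pos_part A t) * \int[P]_t h c (Z t).
Proof.
(* Truncating both coordinates makes the integrand nonnegative on the whole plane, as Tonelli
   requires, without changing it at (Z, A): Z is nonnegative and the truncation of A is
   [pos_part A]. *)
pose g (z : R * R) := (h i (Num.max 0 z.2) * h c (Num.max 0 z.1))%:E.
have mg : measurable_fun setT g.
  apply/measurable_EFinP/measurable_funM.
    apply: measurableT_comp; first exact: measurable_erlang_term.
    exact: measurable_maxr.
  apply: measurableT_comp; first exact: measurable_erlang_term.
  exact: measurable_maxr.
have g0 z : (0 <= g z)%E.
  by rewrite lee_fin mulr_ge0// erlang_term_ge0// le_max lexx.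
have iA := integrable_erlang_term_comp mu_gt0 P (measurable_pos_part mA) (pos_part_ge0 A) i.
have iZ := integrable_erlang_term_comp mu_gt0 P mZ Z0 c.
have gE s t : g (Z s, A t) = (h c (Z s) * h i (pos_part A t))%:E.
  by rewrite /g /= -/(pos_part A t) max_r// mulrC.
transitivity (fine (\int[P]_t g (Z t, A t))%E).
  by congr fine; apply: eq_integral => t _; rewrite gE mulrC.
rewrite (independent_integral mZ mA)//.
transitivity (\int[P]_s (\int[P]_t h i (pos_part A t) * h c (Z s))).
  congr fine; apply: eq_integral => s _.
  transitivity (\int[P]_t (h c (Z s) * h i (pos_part A t))%:E)%E.
    by apply: eq_integral => t _; rewrite gE.
  rewrite -[LHS]fineK; last first.
    by apply: integrable_fin_num => //; exact: integrable_scale.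
  by rewrite -/(Rintegral _ _ _) RintegralZl// mulrC.
by rewrite RintegralZl.
Qed.

Definition sum_erlang_moment l :=
  \sum_(c < l.+1) \int[P]_t h (l - c) (pos_part A t) * \int[P]_t h c (Z t).

Lemma expectation_erlang_term_sum l :
  \int[P]_t h l (S t) = sum_erlang_moment l.
Proof.
transitivity (\int[P]_t \sum_(c <- index_enum 'I_l.+1)
    (h (l - c) (pos_part A t) * h c (Z t))).
  by apply: eq_Rintegral => t _; rewrite erlang_termD.
rewrite Rintegral_sum//.
  by apply: eq_bigr => c _; rewrite expectation_erlang_termM.
move=> c; apply: (@bounded_integrable _ _ _ _ _ 1).
  apply: measurable_funM; apply: measurable_erlang_term_comp => //.
  exact: measurable_pos_part.
move=> t; have p0 := pos_part_ge0 A t.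
have hA := erlang_term_ge0 mu_gt0 (l - c) p0.
have hZ := erlang_term_ge0 mu_gt0 c (Z0 t).
by rewrite ger0_norm; [rewrite mulr_ile1 ?erlang_term_le1|exact: mulr_ge0].
Qed.

(** For x >= 0 the truncated difference is at most x exactly when B <= x + A + Z; then B is
    integrated out first. Replacing A by its positive part costs only a null set. *)
Lemma lindley_cdf_integral x : 0 <= x ->
  P ((fun t => Num.max 0 (B t - A t - Z t)) @^-1` [set y | y <= x]) =
  (\int[P]_t (erlang_cdf mu N (x + S t))%:E)%E.
Proof.
move=> x0.
pose D : set (R * R) := [set z | z.2 <= x + z.1].
have mD : measurable D.
  rewrite -[D]setTI; apply: measurable_fun_le => //.
  exact: measurable_funD.
have mW (f : T -> R) : measurable_fun setT f -> measurable (f @^-1` [set y | y <= x]).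
  move=> mf; rewrite -[X in measurable X]setTI; apply: mf => //.
  by rewrite -set_itvNyc; exact: measurable_itv.
transitivity (\int[P]_t (\1_D (S t, B t))%:E)%E.
  rewrite -[X in P X]setIT -integral_indic//; last first.
    apply: mW; apply: measurable_maxr => //.
    by apply: measurable_funB => //; exact: measurable_funB.
  apply: ae_eq_integral => //.
  - apply/measurable_EFinP; apply: measurable_indic; apply: mW.
    apply: measurable_maxr => //.
    by apply: measurable_funB => //; exact: measurable_funB.
  - apply/measurable_EFinP; apply: measurableT_comp; first exact: measurable_indic.
    exact: measurable_fun_pair.
  - apply: filterS (pos_part_ae mA A0) => t At _.
    rewrite !indicE; congr (_%:R%:E); congr nat_of_bool.
    apply/idP/idP; rewrite !inE /D /S /= At ge_max x0 /=; lra.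
rewrite (independent_integral mS mB (g := fun z => (\1_D z)%:E))//; last first.
  by apply/measurable_EFinP; exact: measurable_indic.
apply: eq_integral => s _; rewrite -PB.
rewrite -[X in P X]setIT -integral_indic//.
rewrite -[X in measurable X]setTI; apply: mB => //.
by rewrite -set_itvNyc; exact: measurable_itv.
Qed.

Lemma lindley_cdf x : 0 <= x ->
  P ((fun t => Num.max 0 (B t - A t - Z t)) @^-1` [set y | y <= x]) =
  (1 - \sum_(k < N) \sum_(l < k.+1) h (k - l) x * sum_erlang_moment l)%:E.
Proof.
move=> x0; rewrite lindley_cdf_integral//.
have ih l : P.-integrable setT (EFin \o (fun t => h l (S t))).
  exact: integrable_erlang_term_comp.
pose F (k : nat) t := \sum_(l <- index_enum 'I_k.+1) h (k - l) x * h l (S t).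
have iF k : P.-integrable setT (EFin \o F k).
  rewrite (_ : EFin \o _ = fun t => \sum_(l <- index_enum 'I_k.+1)
     (h (k - l) x * h l (S t))%:E)%E; last first.
    by apply/funext => u; rewrite sumEFin.
  by apply: integrable_sum => // l _; exact: integrable_scale.
have iFF : P.-integrable setT (EFin \o (fun t => \sum_(k <- index_enum 'I_N) F k t)).
  rewrite (_ : EFin \o _ = fun t => \sum_(k <- index_enum 'I_N) (F k t)%:E)%E; last first.
    by apply/funext => u; rewrite sumEFin.
  by apply: integrable_sum => // k _; exact: iF.
have i1 : P.-integrable setT (EFin \o (fun=> 1 : R)).
  by apply: (@bounded_integrable _ _ _ _ _ 1) => // t; rewrite normr1.
have P1 : \int[P]_t (1 : R) = 1.
  by rewrite Rintegral_cst// mul1r; exact: (congr1 fine (probability_setT P)).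
transitivity (\int[P]_t (1 - \sum_(k <- index_enum 'I_N) F k t)%:E)%E.
  apply: eq_integral => t _; rewrite erlang_cdfE ?addr_ge0 ?pos_part_ge0//.
  by rewrite /erlang_tail; under eq_bigr do rewrite erlang_termD.
rewrite -[LHS]fineK; last first.
  by apply: integrable_fin_num => //; exact: (integrableB measurableT i1 iFF).
rewrite -/(Rintegral _ _ _) RintegralB// P1.
rewrite Rintegral_sum//; congr (_ - _)%:E; apply: eq_bigr => k _.
rewrite /F Rintegral_sum//; last by move=> l; exact: integrable_scale.
apply: eq_bigr => l _.
by rewrite RintegralZl// expectation_erlang_term_sum.
Qed.

End LindleyStep.

(** The transform depends on the law alone, so the one of A_1 serves for every A_n. *)
Lemma eq_lst d (T : measurableType d) (R : realType) (P : probability T R)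
    (X Y : T -> R) :
  measurable_fun setT X -> measurable_fun setT Y ->
  (forall E, measurable E -> P (X @^-1` E) = P (Y @^-1` E)) ->
  lst P X = lst P Y.
Proof.
move=> mX mY XY; apply/funext => s; rewrite /lst unlock; congr fine.
pose X' : {mfun T >-> R} := HB.pack X (isMeasurableFun.Build _ _ _ _ X mX).
pose Y' : {mfun T >-> R} := HB.pack Y (isMeasurableFun.Build _ _ _ _ Y mY).
have mg : measurable_fun setT (fun y : R => (expR (- (s * y)))%:E).
  apply/measurable_EFinP; apply: measurableT_comp; first exact: measurable_expR.
  by apply: measurable_funN; exact: measurable_funM.
have g0 (y : R) : (0 <= (expR (- (s * y)))%:E)%E by rewrite lee_fin expR_ge0.
transitivity (\int[distribution P X']_y (expR (- (s * y)))%:E)%E.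
  by rewrite (ge0_integral_distribution X').
transitivity (\int[distribution P Y']_y (expR (- (s * y)))%:E)%E.
  by apply: eq_measure_integral => M mM _; exact: XY.
by rewrite (ge0_integral_distribution Y').
Qed.

(** * Measurability, sign and independence of the waiting times *)

Section WaitingTimes.
Context d (T : measurableType d) (R : realType) (P : probability T R).
Variables (A B : nat -> T -> R) (w : R).
Hypotheses (w0 : 0 <= w) (mA : forall n, measurable_fun setT (A n))
  (mB : forall n, measurable_fun setT (B n))
  (iAB : mutually_independent P pos_index (join_seq A B)).
Local Notation W := (Wseq w A B).

Lemma WseqS n : (1 <= n)%N ->
  W n.+1 = fun t => Num.max 0 (B n.+1 t - A n t - W n t).
Proof. by case: n. Qed.

Lemma measurable_Wseq n : measurable_fun setT (W n).
Proof.
elim: n => [|[|n] IH]; [exact: measurable_cst..|].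
rewrite WseqS//; apply: measurable_maxr => //.
by apply: measurable_funB => //; exact: measurable_funB.
Qed.

Lemma Wseq_ge0 n t : 0 <= W n t.
Proof. by case: n => [|[|n]] //=; rewrite le_max lexx. Qed.

Definition future_index n (k : nat + nat) : Prop :=
  match k with inl m => (n <= m)%N | inr m => (n < m)%N end.

Let mX k : measurable_fun setT (join_seq A B k).
Proof. by case: k. Qed.

Lemma Wseq_independent n : (1 <= n)%N ->
  independent_of P (future_index n) (join_seq A B) (W n).
Proof.
elim: n => // -[_ _|n IH _].
  apply: independent_ofW (independent_of_cst w iAB) => -[] m //=.
  exact: ltnW.
have {}IH := IH isT.
(* [f1] absorbs A_(n+1) and [f2] then absorbs B_(n+2), one call of [independent_of_comp] for
   each. *)
pose f1 (z : R * R) := z.2 + z.1.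
pose f2 (z : R * R) := Num.max 0 (z.2 - z.1).
have mf1 : measurable_fun setT f1 by exact: measurable_funD.
have mf2 : measurable_fun setT f2.
  by apply: measurable_maxr => //; exact: measurable_funB.
have mW := measurable_Wseq n.+1.
have i1 := @independent_of_comp _ _ _ _ _ _ mX _ _ (inl n.+1) f1 IH (leqnn _) mW mf1.
have m1 : measurable_fun setT (fun t => f1 (W n.+1 t, join_seq A B (inl n.+1) t)).
  by rewrite /f1 /=; exact: measurable_funD.
have i2 := @independent_of_comp _ _ _ _ _ _ mX _ _ (inr n.+2) f2 i1 _ m1 mf2.
have -> : W n.+2 = fun t => f2 (f1 (W n.+1 t, join_seq A B (inl n.+1) t),
                               join_seq A B (inr n.+2) t).
  by apply/funext => t; rewrite WseqS// /f2 /f1 /= opprD addrA.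
apply: independent_ofW (i2 (conj (ltnSn _) isT)).
move=> [m|m] /= nm; split=> //; rewrite ?(ltnW nm)//; last first.
  by apply/eqP => -[mn]; rewrite mn ltnn in nm.
by split=> //; apply/eqP => -[mn]; rewrite mn ltnn in nm.
Qed.

Lemma Wseq_independent_A n : (1 <= n)%N -> forall U V, measurable U -> measurable V ->
  (P (W n @^-1` U `&` A n @^-1` V) = P (W n @^-1` U) * P (A n @^-1` V))%E.
Proof.
move=> n1 U V mU mV.
exact: (independent_of_eq (i := inl n) (Wseq_independent n1) (leqnn n)).
Qed.

Lemma Wseq_independent_B n : (1 <= n)%N -> forall U V, measurable U -> measurable V ->
  (P ((fun t => (pos_part (A n) t + W n t)%R) @^-1` U `&` B n.+1 @^-1` V) =
   P ((fun t => (pos_part (A n) t + W n t)%R) @^-1` U) * P (B n.+1 @^-1` V))%E.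
Proof.
move=> n1 U V mU mV.
pose f (z : R * R) := Num.max 0 z.2 + z.1.
have mf : measurable_fun setT f.
  by apply: measurable_funD => //; exact: measurable_maxr.
have i1 := @independent_of_comp _ _ _ _ _ _ mX _ _ (inl n) f
  (Wseq_independent n1) (leqnn _) (measurable_Wseq n) mf.
exact: (independent_of_eq (i := inr n.+1) i1 (conj (ltnSn n) isT)).
Qed.

End WaitingTimes.

(** * The weights of the statement as convolutions of Poisson moments *)

Section MomentAlgebra.
Variables (R : realType) (N : nat) (mu w : R) (a : nat -> R).
Hypothesis mu_gt0 : 0 < mu.

(** The mean of h_b(A_n), by [expectation_erlang_term_lst], once [a b] is the b-th derivative of the
    transform at mu. *)
Let m b : R := (- mu) ^+ b / b`!%:R * a b.

Lemma varpi2_posE j :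
  varpi2_pos N mu w a j = \sum_(c < (N - j).+1) m (N - j - c) * erlang_term mu c w.
Proof.
rewrite /varpi2_pos mulr_sumr; apply: eq_bigr => c _.
have cN : (c <= N - j)%N by rewrite -ltnS.
rewrite /m /erlang_term -[in (- mu) ^+ (N - j)](subnK cN) exprD.
have -> : (mu * w) ^+ c = (- mu) ^+ c * (- w) ^+ c by rewrite -exprMn mulrNN.
ring.
Qed.

(** The factor (-1/(2 mu))^c lowers the power of -mu to N-j-c and raises that of 2 to i+c. For
    [i = 0] only the term c = 0 survives. *)
Lemma p_posE i j :
  p_pos N mu a i j = \sum_(c < (N - j).+1) m (N - j - c) * erlang_race_pmf R i c.
Proof.
rewrite /p_pos /erlang_race_pmf; case: eqP => [_|_].
  rewrite big_ord_recl subn0 /= mulr1 big1 ?addr0// => c _.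
  by rewrite mulr0.
rewrite mulr_sumr; apply: eq_bigr => c _.
have cN : (c <= N - j)%N by rewrite -ltnS.
rewrite /m -[in (- mu) ^+ (N - j)](subnK cN) !exprD.
have -> : (- (2 * mu)^-1) ^+ c = ((- mu) ^+ c)^-1 / 2 ^+ c.
  by rewrite -exprVn -exprVn -exprMn; congr (_ ^+ _); field; rewrite gt_eqF.
have n0 : (- mu) ^+ c != 0 by rewrite expf_neq0// oppr_eq0 gt_eqF.
have t0 k : 2 ^+ k != 0 :> R by rewrite expf_neq0.
have f0 : ((N - j - c)`!)%:R != 0 :> R by rewrite pnatr_eq0 -lt0n fact_gt0.
by field; rewrite n0 f0 !t0.
Qed.

(** The initial vector and every row of the matrix sum to one by the choice of their entry at 0.
    This yields the complement form of the weight at 0 that [erlang_mixtureE] requires. *)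
Lemma sum_varpi_aux k : \sum_(i < N.+1) varpi_aux N mu w a k i = 1.
Proof.
elim: k => [|k IH] /=.
  rewrite big_ord_recl /= {1}/varpi2 eqxx big_add1 /= big_mkord.
  by rewrite subrK.
rewrite exchange_big /= -[RHS]IH; apply: eq_bigr => i _.
rewrite -mulr_sumr big_ord_recl /= {1}/ptrans eqxx big_add1 /= big_mkord.
by rewrite subrK mulr1.
Qed.

Lemma varpi_aux0 k :
  varpi_aux N mu w a k 0 = 1 - \sum_(1 <= j < N.+1) varpi_aux N mu w a k j.
Proof.
rewrite -(sum_varpi_aux k) -(big_mkord xpredT (varpi_aux N mu w a k)).
by rewrite [in RHS]big_ltn// addrK.
Qed.

End MomentAlgebra.

Theorem theorem5p1 (R : realType) (d : measure_display) (T : measurableType d)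
  (P : probability T R) (A B : nat -> T -> R) (N : nat) (mu w : R) :
  (1 <= N)%N -> 0 < mu -> 0 <= w ->
  (forall n, measurable_fun setT (A n)) ->
  (forall n, measurable_fun setT (B n)) ->
  (* {A_n}_{n>=1} and {B_n}_{n>=1} jointly mutually independent *)
  mutually_independent P pos_index (join_seq A B) ->
  (* A_n nonnegative and identically distributed *)
  (forall n, (1 <= n)%N -> P (A n @^-1` [set y | 0 <= y]) = 1%E) ->
  (forall n E, (1 <= n)%N -> measurable E ->
     P (A n @^-1` E) = P (A 1%N @^-1` E)) ->
  (* B_n Erlang(N, mu) *)
  (forall n x, (1 <= n)%N ->
     P (B n @^-1` [set y | y <= x]) = (erlang_cdf mu N x)%:E) ->
  let a := fun m : nat => derive1n m (lst P (A 1%N)) mu in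
  forall n, (2 <= n)%N -> forall x, 0 <= x ->
    P (Wseq w A B n @^-1` [set y | y <= x]) =
    (\sum_(i < N.+1) varpi N mu w a n i * erlang_cdf mu i x)%:E.
Proof.
move=> _ mu0 w0 mA mB iAB A0 idA PB a.
pose W := Wseq w A B.
pose mom n c := \int[P]_t erlang_term mu c (W n t).
have EA n b : (1 <= n)%N ->
    \int[P]_t erlang_term mu b (pos_part (A n) t) = (- mu) ^+ b / b`!%:R * a b.
  move=> n1; rewrite (expectation_erlang_term_lst (mA n) (A0 n n1))//.
  by rewrite (eq_lst (mA n) (mA 1%N))// => E mE; exact: idA.
(* The passage from W_n to W_(n+1) for any weights of convolution form; it uses W_n only through its
   moments [mom n c], so it serves both the constant W_1 and the later mixtures. *)
have step n (u : nat -> R) : (1 <= n)%N ->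
    u 0%N = 1 - \sum_(1 <= j < N.+1) u j ->
    (forall j, (0 < j <= N)%N -> u j = \sum_(c < (N - j).+1)
       ((- mu) ^+ (N - j - c) / (N - j - c)`!%:R * a (N - j - c)%N) * mom n c) ->
    forall x, 0 <= x -> P (W n.+1 @^-1` [set y | y <= x]) =
      (\sum_(i < N.+1) u i * erlang_cdf mu i x)%:E.
  move=> n1 u0 uE x x0.
  rewrite /W WseqS// (lindley_cdf mu0 (mA n) (mB n.+1) (measurable_Wseq w mA mB n)
    (Wseq_ge0 A B w0 n) (A0 n n1) (fun y => PB n.+1 y isT) (Wseq_independent_A w mA mB iAB n1)
    (Wseq_independent_B w mA mB iAB n1) x0).
  rewrite -(@erlang_mixtureE _ _ _ _ u)// => j jN; rewrite uE//.
  rewrite /sum_erlang_moment; apply: eq_bigr => c _.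
  by rewrite EA.
have mix k x : 0 <= x -> P (W k.+2 @^-1` [set y | y <= x]) =
    (\sum_(i < N.+1) varpi_aux N mu w a k i * erlang_cdf mu i x)%:E.
  elim: k x => [|k IH] x x0.
    apply: (step 1%N) => //; first exact: varpi_aux0.
    move=> j /andP[j0 jN] /=.
    rewrite /varpi2 gtn_eqF// varpi2_posE; apply: eq_bigr => c _.
    (* As W_1 is the constant w, its moment is h_c(w). *)
    by rewrite /mom /W /= Rintegral_cst// (_ : fine (P _) = 1) ?mulr1//;
      exact: (congr1 fine (probability_setT P)).
  apply: (step k.+2) => //; first exact: varpi_aux0.
  move=> j /andP[j0 jN] /=.
  transitivity (\sum_(i < N.+1) \sum_(c < (N - j).+1) varpi_aux N mu w a k i *
      ((- mu) ^+ (N - j - c) / (N - j - c)`!%:R * a (N - j - c)%N * erlang_race_pmf R i c)).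
    by apply: eq_bigr => i _; rewrite /ptrans gtn_eqF// p_posE// mulr_sumr.
  rewrite exchange_big /=; apply: eq_bigr => c _.
  (* The induction hypothesis makes W_(k+2) a mixture, so its moments are mixtures of the race
     weights, matching those in [p_posE]. *)
  rewrite /mom (expectation_erlang_term_mixture mu0 (measurable_Wseq w mA mB k.+2)
    (Wseq_ge0 A B w0 k.+2) IH) mulr_sumr.
  by apply: eq_bigr => i _; rewrite mulrCA.
move=> [|[|n]]// _ x x0.
by rewrite mix// /varpi !subSS subn0.
Qed.
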